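(* The following decision problem is decidable: given a simple signature, a decidable effect theory $\mathcal{T}$ over it, and a uniformly simple family of closed handlers over it (i.e. a template $x:\alpha\mid z:\beta\vdash T_{\mathsf{op}}$ for each operation symbol $\mathsf{op}:\alpha\to\beta$), decide whether the family is correct, i.e. whether for every computation type $\underline{C}$, the carrier $|[\![\underline{C}]\!]|$ equipped with the operations $\mathsf{op}_H(a,\kappa)=[\![T_{\mathsf{op}}]\!]_{[\![\underline{C}]\!]}(a,\kappa)$ forms a model of $\mathcal{T}$.
   Context: A simple signature is a finite set of operation symbols $\mathsf{op}:\alpha\to\beta$ with types $\alpha,\beta::=1\mid\alpha\times\beta\mid\sum_{\ell\in L}\alpha_\ell$ ($L$ finite), no base types and no function symbols; every such type denotes a finite set. Signature values are built from variables, $\langle\rangle$, pairs and injections. Templates over a value context $\Gamma$ and template context $Z=z_1:\alpha_1,\dots,z_n:\alpha_n$ are $T::=z(V)\mid\mathsf{match}\ V\ \mathsf{with}\ \langle x,y\rangle\mapsto T\mid\mathsf{match}\ V\ \mathsf{with}\ \{\ell(x_\ell)\mapsto T_\ell\}_{\ell\in L}\mid\mathsf{op}_V(x:\beta.T)$ with evident typing. An effect theory is a finite set of equations $\Gamma\mid Z\vdash T_1=T_2$. For a set $|\mathcal{M}|$ with maps $\mathsf{op}_{\mathcal{M}}:[\![\alpha]\!]\times|\mathcal{M}|^{[\![\beta]\!]}\to|\mathcal{M}|$, templates denote maps $[\![T]\!]_{\mathcal{M}}$: $z_j(V)\mapsto b_j([\![V]\!](a))$, matches select the branch, $\mathsf{op}_V(x.T)\mapsto\mathsf{op}_{\mathcal{M}}([\![V]\!](a),x\mapsto[\![T]\!]_{\mathcal{M}}(\langle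 a,x\rangle,b))$; a model satisfies all equations of $\mathcal{T}$. A simple-signature effect theory corresponds to an ordinary finitary equational theory $\mathcal{T}_f$ with finitely many function symbols $\mathsf{op}_a$ of arity $|[\![\beta]\!]|$ (one for each $\mathsf{op}:\alpha\to\beta$ and $a\in[\![\alpha]\!]$) and finitely many axioms $T_1^c=T_2^c$ (one for each equation $\Gamma\mid Z\vdash T_1=T_2$ of $\mathcal{T}$ and $c\in[\![\Gamma]\!]$), where $T^c$ is the term obtained by evaluating the value parts at $c$; $\mathcal{T}$ is decidable if provability of equations in $\mathcal{T}_f$ is decidable. Value types $A::=1\mid A\times B\mid\sum_\ell A_\ell\mid U\underline{C}$ and computation types $\underline{C}::=FA\mid\prod_\ell\underline{C}_\ell\mid A\to\underline{C}$ are interpreted: value types as sets ($[\![U\underline{C}]\!]$ the carrier of $[\![\underline{C}]\!]$), $[\![FA]\!]$ the free model of $\mathcal{T}$ over $[\![A]\!]$, products as product models with componentwise operations, $[\![A\to\underline{C}]\!]$ as the exponent model with pointwise operations. In $[\![T_{\mathsf{op}}]\!]_{[\![\underline{C}]\!]}$ operations are interpreted by the original operations of $[\![\underline{C}]\!]$. *)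

(* Defs.v *)
From Stdlib Require List.
From Stdlib Require Import ClassicalEpsilon.
From mathcomp Require Import all_boot.

Set Implicit Arguments.
Unset Strict Implicit.
Unset Printing Implicit Defensive.

(*    Labels of a finite sum are the positions 0..|L|-1 of the list.   *)
Inductive sty : Type := S1 | SPair (a b : sty) | SSum (l : seq sty).

Inductive sval : Type := VUnit | VPair (u w : sval) | VInj (i : nat) (u : sval).

Fixpoint vty (v : sval) (a : sty) : bool :=
  match v, a with
  | VUnit, S1 => true
  | VPair u w, SPair a b => vty u a && vty w b
  | VInj i u, SSum l => (i < size l) && vty u (nth S1 l i)
  | _, _ => false
  end.

Definition den (a : sty) : Type := {v : sval | vty v a}.

(* A fixed enumeration of [[alpha]] (used to order the arguments of the *)
(* finitary function symbols op_a of T_f).                               *)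
Fixpoint enum_sty (a : sty) : seq sval :=
  match a with
  | S1 => [:: VUnit]
  | SPair a b => [seq VPair u w | u <- enum_sty a, w <- enum_sty b]
  | SSum l =>
      (fix go (l : seq sty) (i : nat) : seq sval :=
         match l with
         | [::] => [::]
         | a :: l' => map (VInj i) (enum_sty a) ++ go l' i.+1
         end) l 0
  end.

Definition signature := seq (sty * sty).
Definition argty (sig : signature) (o : nat) : sty := (nth (S1, S1) sig o).1.
Definition resty (sig : signature) (o : nat) : sty := (nth (S1, S1) sig o).2.

(* 2. Values and templates (de Bruijn indices for value variables;     *)
(*    template variables z_j are referred to by their position j in Z). *)
Inductive vterm : Type :=
| VVar (n : nat) | VUnitT | VPairT (v w : vterm) | VInjT (i : nat) (v : vterm).

(* TZ j V          = z_j(V)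
   TMPair V T      = match V with <x,y> |-> T    (T in context x :: y :: Gamma)
   TMSum V Ts      = match V with {l(x_l) |-> T_l} (T_l in context x_l :: Gamma)
   TOp o V T       = op_V(x:beta. T)              (T in context x :: Gamma)   *)
Inductive tmpl : Type :=
| TZ (j : nat) (V : vterm)
| TMPair (V : vterm) (T : tmpl)
| TMSum (V : vterm) (Ts : seq tmpl)
| TOp (o : nat) (V : vterm) (T : tmpl).

Definition tmpl_dflt : tmpl := TZ 0 VUnitT.

Inductive vtyped : seq sty -> vterm -> sty -> Prop :=
| vt_var G n : n < size G -> vtyped G (VVar n) (nth S1 G n)
| vt_unit G : vtyped G VUnitT S1
| vt_pair G v w a b : vtyped G v a -> vtyped G w b -> vtyped G (VPairT v w) (SPair a b)
| vt_inj G i v l : i < size l -> vtyped G v (nth S1 l i) -> vtyped G (VInjT i v) (SSum l).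

Inductive ttyped (sig : signature) : seq sty -> seq sty -> tmpl -> Prop :=
| tt_z G Z j V : j < size Z -> vtyped G V (nth S1 Z j) -> ttyped sig G Z (TZ j V)
| tt_mpair G Z V T a b :
    vtyped G V (SPair a b) -> ttyped sig (a :: b :: G) Z T -> ttyped sig G Z (TMPair V T)
| tt_msum G Z V Ts l :
    vtyped G V (SSum l) -> size Ts = size l ->
    (forall i, i < size l -> ttyped sig (nth S1 l i :: G) Z (nth tmpl_dflt Ts i)) ->
    ttyped sig G Z (TMSum V Ts)
| tt_op G Z o V T :
    o < size sig -> vtyped G V (argty sig o) ->
    ttyped sig (resty sig o :: G) Z T -> ttyped sig G Z (TOp o V T).

Record equation := Eqn { eq_ctx : seq sty; eq_tctx : seq sty; eq_lhs : tmpl; eq_rhs : tmpl }.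
Definition theory := seq equation.

Definition wf_theory (sig : signature) (E : theory) : Prop :=
  forall e, List.In e E ->
    ttyped sig (eq_ctx e) (eq_tctx e) (eq_lhs e) /\ ttyped sig (eq_ctx e) (eq_tctx e) (eq_rhs e).

Definition wf_handlers (sig : signature) (H : seq tmpl) : Prop :=
  size H = size sig /\
  forall o, o < size sig -> ttyped sig [:: argty sig o] [:: resty sig o] (nth tmpl_dflt H o).

(* An operation op : [[alpha]] x |M|^[[beta]] -> |M| is represented on raw *)
(* values; for well-typed templates only typed arguments are ever used.   *)
Record model := Model { car : Type; mop : nat -> sval -> (sval -> car) -> car }.

Fixpoint veval (env : seq sval) (V : vterm) : sval :=
  match V with
  | VVar n => nth VUnit env n
  | VUnitT => VUnit
  | VPairT v w => VPair (veval env v) (veval env w)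
  | VInjT i v => VInj i (veval env v)
  end.

(* [[T]]_M (env, b); b j v is the value of z_j at v.  The default
   [b 0 VUnit] is only reached for ill-typed data.                  *)
Fixpoint teval (M : model) (b : nat -> sval -> car M) (env : seq sval) (T : tmpl) : car M :=
  match T with
  | TZ j V => b j (veval env V)
  | TMPair V T =>
      match veval env V with
      | VPair u w => @teval M b (u :: w :: env) T
      | _ => b 0 VUnit
      end
  | TMSum V Ts =>
      match veval env V with
      | VInj i u =>
          (fix go (Ts : seq tmpl) (i : nat) : car M :=
             match Ts, i with
             | T :: _, 0 => @teval M b (u :: env) T
             | _ :: Ts', i'.+1 => go Ts' i'
             | [::], _ => b 0 VUnit
             end) Ts i
      | _ => b 0 VUnit
      end
  | TOp o V T => @mop M o (veval env V) (fun x => @teval M b (x :: env) T)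
  end.

Definition satisfies (M : model) (E : theory) : Prop :=
  forall e, List.In e E ->
  forall env : seq sval, all2 vty env (eq_ctx e) ->
  forall b : nat -> sval -> car M,
    teval b env (eq_lhs e) = teval b env (eq_rhs e).

Inductive term (X : Type) : Type :=
| TV (x : X)
| TO (o : nat) (a : sval) (ts : seq (term X)).   (* op_a applied to its |[[beta]]| arguments,
                                                    listed along enum_sty beta *)
Arguments TV {X}.
Arguments TO {X}.

Fixpoint wft (sig : signature) (X : Type) (t : term X) : bool :=
  match t with
  | TV _ => true
  | TO o a ts =>
      [&& o < size sig, vty a (argty sig o),
          size ts == size (enum_sty (resty sig o)) & all (@wft sig X) ts]
  end.

Fixpoint tsubst (X Y : Type) (s : X -> term Y) (t : term X) : term Y :=
  match t with
  | TV x => s x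
  | TO o a ts => TO o a (map (tsubst s) ts)
  end.

(* Terms over variables (j, v) standing for z_j(v); the term T^c. *)
Definition termmodel (sig : signature) : model :=
  @Model (term (nat * sval)) (fun o a k => TO o a (map k (enum_sty (resty sig o)))).

Definition Tc (sig : signature) (c : seq sval) (T : tmpl) : term (nat * sval) :=
  @teval (termmodel sig) (fun j v => TV (j, v)) c T.

Inductive prov (sig : signature) (E : theory) (X : Type) : term X -> term X -> Prop :=
| pv_refl (t : term X) : wft sig t -> prov sig E t t
| pv_sym (t s : term X) : prov sig E t s -> prov sig E s t
| pv_trans (t s r : term X) : prov sig E t s -> prov sig E s r -> prov sig E t r
| pv_cong o a (ts ss : seq (term X)) :
    wft sig (TO o a ts) -> wft sig (TO o a ss) ->
    List.Forall2 (@prov sig E X) ts ss -> prov sig E (TO o a ts) (TO o a ss)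
| pv_ax e c (s : nat * sval -> term X) :
    List.In e E -> all2 vty c (eq_ctx e) ->
    wft sig (tsubst s (Tc sig c (eq_lhs e))) ->
    wft sig (tsubst s (Tc sig c (eq_rhs e))) ->
    prov sig E (tsubst s (Tc sig c (eq_lhs e))) (tsubst s (Tc sig c (eq_rhs e))).
Arguments prov sig E {X}.

Section FreeModel.
Variables (sig : signature) (E : theory) (X : Type).

Definition fcar : Type := {P : term X -> Prop | exists t, wft sig t /\ P = prov sig E t}.

Definition fcls (t : term X) (h : wft sig t) : fcar :=
  exist _ (prov sig E t) (ex_intro _ t (conj h erefl)).

Definition frep (c : fcar) : term X :=
  proj1_sig (constructive_indefinite_description _ (proj2_sig c)).

Definition fop (o : nat) (a : sval) (k : sval -> fcar) : fcar :=
  let t := TO o a (map (fun x => frep (k x)) (enum_sty (resty sig o))) in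
  (if wft sig t as bb return wft sig t = bb -> fcar
   then fun h => fcls h else fun _ => k VUnit) erefl.

Definition freemod : model := @Model fcar fop.
End FreeModel.

Definition unitmod : model := @Model unit (fun _ _ _ => tt).
Definition prodmod (M N : model) : model :=
  @Model (car M * car N)%type
    (fun o a k => (@mop M o a (fun x => (k x).1), @mop N o a (fun x => (k x).2))).
Definition expmod (Y : Type) (M : model) : model :=
  @Model (Y -> car M) (fun o a k => fun y => @mop M o a (fun v => k v y)).

Inductive vtyp : Type :=
| VOne | VProd (A B : vtyp) | VSum (As : seq vtyp) | VU (C : ctyp)
with ctyp : Type :=
| CF (A : vtyp) | CProd (Cs : seq ctyp) | CArr (A : vtyp) (C : ctyp).

Section Interp.
Variables (sig : signature) (E : theory).

Fixpoint vden (A : vtyp) : Type :=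
  match A with
  | VOne => unit
  | VProd A B => (vden A * vden B)%type
  | VSum As =>
      (fix sd (l : seq vtyp) : Type :=
         match l with [::] => Empty_set | A :: l' => (vden A + sd l')%type end) As
  | VU C => car (cden C)
  end
with cden (C : ctyp) : model :=
  match C with
  | CF A => freemod sig E (vden A)
  | CProd Cs =>
      (fix pd (l : seq ctyp) : model :=
         match l with [::] => unitmod | C :: l' => prodmod (cden C) (pd l') end) Cs
  | CArr A C => expmod (vden A) (cden C)
  end.
End Interp.

Definition hmodel (H : seq tmpl) (M : model) : model :=
  @Model (car M) (fun o a k => @teval M (fun _ v => k v) [:: a] (nth tmpl_dflt H o)).

Definition handlers_correct (sig : signature) (E : theory) (H : seq tmpl) : Prop :=
  forall C : ctyp, satisfies (hmodel H (cden sig E C)) E.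

Inductive prog : Type :=
| PZero | PSucc | PProj (i : nat) | PComp (f : prog) (gs : seq prog)
| PRec (f g : prog) | PMin (f : prog) | POracle.

Inductive ev (orc : nat -> nat) : prog -> seq nat -> nat -> Prop :=
| ev_zero v : ev orc PZero v 0
| ev_succ x v : ev orc PSucc (x :: v) x.+1
| ev_proj i v : i < size v -> ev orc (PProj i) v (nth 0 v i)
| ev_oracle x v : ev orc POracle (x :: v) (orc x)
| ev_comp f gs v ys y : evs orc gs v ys -> ev orc f ys y -> ev orc (PComp f gs) v y
| ev_rec0 f g v y : ev orc f v y -> ev orc (PRec f g) (0 :: v) y
| ev_recS f g n v r y :
    ev orc (PRec f g) (n :: v) r -> ev orc g (n :: r :: v) y -> ev orc (PRec f g) (n.+1 :: v) y
| ev_min f v n :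
    ev orc f (n :: v) 0 -> (forall m, m < n -> exists k, ev orc f (m :: v) k.+1) ->
    ev orc (PMin f) v n
with evs (orc : nat -> nat) : seq prog -> seq nat -> seq nat -> Prop :=
| evs_nil v : evs orc [::] v [::]
| evs_cons g gs v y ys : ev orc g v y -> evs orc gs v ys -> evs orc (g :: gs) v (y :: ys).

(* Injective encodings of the syntax into nat (Cantor pairing). *)
Definition cpair (x y : nat) : nat := ((x + y) * (x + y).+1)./2 + y.
Definition clist (A : Type) (f : A -> nat) : seq A -> nat :=
  fix go l := match l with [::] => 0 | x :: l' => (cpair (f x) (go l')).+1 end.

Fixpoint code_sty (a : sty) : nat :=
  match a with
  | S1 => cpair 0 0
  | SPair a b => cpair 1 (cpair (code_sty a) (code_sty b))
  | SSum l => cpair 2 (clist code_sty l)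
  end.
Fixpoint code_sval (v : sval) : nat :=
  match v with
  | VUnit => cpair 0 0
  | VPair u w => cpair 1 (cpair (code_sval u) (code_sval w))
  | VInj i u => cpair 2 (cpair i (code_sval u))
  end.
Fixpoint code_vterm (v : vterm) : nat :=
  match v with
  | VVar n => cpair 0 n
  | VUnitT => cpair 1 0
  | VPairT v w => cpair 2 (cpair (code_vterm v) (code_vterm w))
  | VInjT i v => cpair 3 (cpair i (code_vterm v))
  end.
Fixpoint code_tmpl (T : tmpl) : nat :=
  match T with
  | TZ j V => cpair 0 (cpair j (code_vterm V))
  | TMPair V T => cpair 1 (cpair (code_vterm V) (code_tmpl T))
  | TMSum V Ts => cpair 2 (cpair (code_vterm V) (clist code_tmpl Ts))
  | TOp o V T => cpair 3 (cpair o (cpair (code_vterm V) (code_tmpl T)))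
  end.
Fixpoint code_term (t : term nat) : nat :=
  match t with
  | TV n => cpair 0 n
  | TO o a ts => cpair 1 (cpair o (cpair (code_sval a) (clist code_term ts)))
  end.
Definition code_sig (sig : signature) : nat :=
  clist (fun p => cpair (code_sty p.1) (code_sty p.2)) sig.
Definition code_eqn (e : equation) : nat :=
  cpair (clist code_sty (eq_ctx e))
    (cpair (clist code_sty (eq_tctx e)) (cpair (code_tmpl (eq_lhs e)) (code_tmpl (eq_rhs e)))).
Definition code_input (sig : signature) (E : theory) (H : seq tmpl) : nat :=
  cpair (code_sig sig) (cpair (clist code_eqn E) (clist code_tmpl H)).
Definition code_query (t1 t2 : term nat) : nat := cpair (code_term t1) (code_term t2).

Definition decides_Tf (sig : signature) (E : theory) (orc : nat -> nat) : Prop :=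
  forall t1 t2 : term nat,
    (prov sig E t1 t2 -> orc (code_query t1 t2) = 1) /\
    (~ prov sig E t1 t2 -> orc (code_query t1 t2) = 0).

(* Main.v *)
(** The handlers form a model on every [cden C] as soon as they do so on the free
    models, because the models satisfying the interpreted equations are closed
    under products and powers.  On the free model over [X] the handled template
    is the class of the term obtained by handling in the term model, so by
    closure of provability under substitution correctness amounts to the
    provability of the finitely many equations [hterm env T1 = hterm env T2], for
    [T1 = T2] in the theory and [env] a valuation of its context; conversely a
    free model over a large enough finite sum of units separates all the
    variables occurring in such an equation.  These provability questions are put
    to the oracle.

    The queries are computed by a first-order functional program with general
    recursion.  Such programs are oracle-computable: the [n]-th Kleene iterate on
    arguments below [B] is a finite table, primitive recursive in [n] and [B], and
    one minimises over [n = B] until the requested entry is defined. *)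
Require Import Defs.
From HB Require Import structures.
From Stdlib Require Import ClassicalEpsilon FunctionalExtensionality.
From Stdlib Require Import PropExtensionality ProofIrrelevance.
From mathcomp Require Import all_boot zify.

Set Implicit Arguments.
Unset Strict Implicit.
Unset Printing Implicit Defensive.

(** * Oracle computability *)

Arguments cpair : simpl never.

Lemma ev_comp1 orc f g v x y :
  ev orc g v x -> ev orc f [:: x] y -> ev orc (PComp f [:: g]) v y.
Proof. by move=> gx; apply: ev_comp; do !constructor. Qed.

Lemma ev_comp2 orc f g1 g2 v x1 x2 y :
  ev orc g1 v x1 -> ev orc g2 v x2 -> ev orc f [:: x1; x2] y ->
  ev orc (PComp f [:: g1; g2]) v y.
Proof. by move=> g1x g2x; apply: ev_comp; do !constructor. Qed.

Lemma ev_comp3 orc f g1 g2 g3 v x1 x2 x3 y :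
  ev orc g1 v x1 -> ev orc g2 v x2 -> ev orc g3 v x3 ->
  ev orc f [:: x1; x2; x3] y -> ev orc (PComp f [:: g1; g2; g3]) v y.
Proof. by move=> g1x g2x g3x; apply: ev_comp; do !constructor. Qed.

Lemma ev_rec orc f g v y h n :
  ev orc f v y -> (forall m r, ev orc g [:: m, r & v] (h m r)) ->
  ev orc (PRec f g) (n :: v) (nat_rect (fun=> nat) y h n).
Proof.
by move=> fy gh; elim: n => [|n IH] /=; [constructor | apply: ev_recS IH _].
Qed.

Lemma ev_nth orc i v y : i < size v -> nth 0 v i = y -> ev orc (PProj i) v y.
Proof. by move=> ltiv <-; constructor. Qed.

Ltac proj :=
  lazymatch goal with |- ev _ (PProj ?i) ?v _ =>
    let y := eval cbv [nth] in (nth 0 v i) in exact (@ev_nth _ i v y isT erefl)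
  end.

Lemma ev_const c : exists p, forall orc v, ev orc p v c.
Proof.
elim: c => [|c [p pP]]; first by exists PZero; constructor.
by exists (PComp PSucc [:: p]) => orc v; apply: ev_comp1 (pP _ _) _; constructor.
Qed.

Definition pred_prog := PRec PZero (PProj 0).

Lemma ev_pred orc x : ev orc pred_prog [:: x] x.-1.
Proof.
have -> : x.-1 = nat_rect (fun=> nat) 0 (fun m _ => m) x by case: x.
by apply: ev_rec => [|m r]; [constructor | proj].
Qed.

Definition add_prog := PRec (PProj 0) (PComp PSucc [:: PProj 1]).

Lemma ev_add orc x y : ev orc add_prog [:: x; y] (x + y).
Proof.
have -> : x + y = nat_rect (fun=> nat) y (fun _ r => r.+1) x.
  by elim: x => //= x <-.
apply: ev_rec => [|m r]; first by proj.
by apply: (@ev_comp1 _ _ _ _ r); [proj | constructor].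
Qed.

(* Computes [y - x]: the recursion is on the subtrahend. *)
Definition sub_prog := PRec (PProj 0) (PComp pred_prog [:: PProj 1]).

Lemma ev_sub orc x y : ev orc sub_prog [:: x; y] (y - x).
Proof.
have -> : y - x = nat_rect (fun=> nat) y (fun _ r => r.-1) x.
  by elim: x => [|x /= <-] /=; rewrite ?subn0 ?subnS.
apply: ev_rec => [|m r]; first by proj.
by apply: (@ev_comp1 _ _ _ _ r); [proj | exact: ev_pred].
Qed.

Definition tri n := (n * n.+1)./2.
Arguments tri : simpl never.

Lemma triS n : tri n.+1 = tri n + n.+1.
Proof.
rewrite /tri; have -> : n.+1 * n.+2 = n * n.+1 + n.+1.*2 by lia.
by rewrite halfD odd_double andbF doubleK.
Qed.

Definition tri_prog :=
  PRec PZero (PComp add_prog [:: PComp PSucc [:: PProj 0]; PProj 1]).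

Lemma ev_tri orc n : ev orc tri_prog [:: n] (tri n).
Proof.
have -> : tri n = nat_rect (fun=> nat) 0 (fun m r => m.+1 + r) n.
  by elim: n => //= n <-; rewrite triS addnC.
apply: ev_rec => [|m r]; first by constructor.
apply: (@ev_comp2 _ _ _ _ _ m.+1 r); [|proj|exact: ev_add].
by apply: (@ev_comp1 _ _ _ _ m); [proj | constructor].
Qed.

Definition pair_prog :=
  PComp add_prog [:: PComp tri_prog [:: add_prog]; PProj 1].

Lemma ev_pair orc x y : ev orc pair_prog [:: x; y] (cpair x y).
Proof.
apply: (@ev_comp2 _ _ _ _ _ (tri (x + y)) y); [|proj|exact: ev_add].
by apply: ev_comp1 (ev_add _ _ _) (ev_tri _ _).
Qed.

(* The index [x + y] of the antidiagonal on which [cpair x y] lies. *)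
Fixpoint diag z :=
  if z is z'.+1 then diag z' + (1 - (tri (diag z').+1 - z)) else 0.

Definition usnd z := z - tri (diag z).
Definition ufst z := diag z - usnd z.

Lemma tri_le m n : m <= n -> tri m <= tri n.
Proof.
elim: n => [|n IH]; first by case: m.
by rewrite triS leq_eqVlt => /predU1P[->|]; [rewrite triS | lia].
Qed.

Lemma diagP z : tri (diag z) <= z < tri (diag z).+1.
Proof.
elim: z => // z; rewrite [diag z.+1]/=; set d := diag z => /andP[le1 lt2].
have := triS d; have := triS d.+1.
case: (ltnP z.+1 (tri d.+1)) => cmp.
  have -> : 1 - (tri d.+1 - z.+1) = 0 by lia.
  by rewrite addn0; lia.
have -> : 1 - (tri d.+1 - z.+1) = 1 by lia.
by rewrite addn1; lia.
Qed.

Lemma diag_cpair x y : diag (cpair x y) = x + y.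
Proof.
have /andP[] := diagP (cpair x y); set d := diag _.
rewrite /cpair -/(tri (x + y)) => le1 lt2; have := triS (x + y).
case: (ltngtP d (x + y)) => // lt; have := tri_le lt; lia.
Qed.

Lemma usndK x y : usnd (cpair x y) = y.
Proof. by rewrite /usnd diag_cpair /cpair -/(tri _) addKn. Qed.

Lemma ufstK x y : ufst (cpair x y) = x.
Proof. by rewrite /ufst usndK diag_cpair addnK. Qed.

Lemma cpair_inj x y x' y' : cpair x y = cpair x' y' -> x = x' /\ y = y'.
Proof.
by move=> e; split; [rewrite -(ufstK x y) e ufstK | rewrite -(usndK x y) e usndK].
Qed.

Definition diag_prog :=
  PRec PZero
    (PComp add_prog [:: PProj 1;
       PComp sub_prog [::
         PComp sub_prog [:: PComp PSucc [:: PProj 0];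
                            PComp tri_prog [:: PComp PSucc [:: PProj 1]]];
         PComp PSucc [:: PZero]]]).

Lemma ev_diag orc z : ev orc diag_prog [:: z] (diag z).
Proof.
have -> : diag z =
    nat_rect (fun=> nat) 0 (fun m r => r + (1 - (tri r.+1 - m.+1))) z.
  by elim: z => //= z <-.
have S v p x : ev orc p v x -> ev orc (PComp PSucc [:: p]) v x.+1.
  by move=> px; apply: ev_comp1 px _; constructor.
apply: ev_rec => [|m r]; first by constructor.
apply: ev_comp2 (ev_add _ _ _); first by proj.
apply: ev_comp2 (ev_sub _ _ _); last by apply: (S _ _ 0); constructor.
apply: ev_comp2 (ev_sub _ _ _); first by apply: S; proj.
by apply: ev_comp1 (ev_tri _ _); apply: S; proj.
Qed.

Definition snd_prog :=
  PComp sub_prog [:: PComp tri_prog [:: diag_prog]; PProj 0].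

Lemma ev_snd orc z : ev orc snd_prog [:: z] (usnd z).
Proof.
apply: ev_comp2 (ev_sub _ _ _); last by proj.
by apply: ev_comp1 (ev_diag _ _) (ev_tri _ _).
Qed.

Definition fst_prog := PComp sub_prog [:: snd_prog; diag_prog].

Lemma ev_fst orc z : ev orc fst_prog [:: z] (ufst z).
Proof. by apply: ev_comp2 (ev_snd _ _) (ev_diag _ _) (ev_sub _ _ _). Qed.

Definition cons_prog := PComp PSucc [:: pair_prog].

Lemma ev_cons orc x l : ev orc cons_prog [:: x; l] (cpair x l).+1.
Proof. by apply: ev_comp1 (ev_pair _ _ _) _; constructor. Qed.

Notation lcode := (clist (fun n : nat => n)).

Definition lookup t i :=
  ufst (nat_rect (fun=> nat) t (fun _ r => usnd r.-1) i).-1.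

Lemma lookup_lcode l i : lookup (lcode l) i = nth 0 l i.
Proof.
have drops : nat_rect (fun=> nat) (lcode l) (fun _ r => usnd r.-1) i =
             lcode (drop i l).
  elim: i => [|i /= ->]; first by rewrite drop0.
  rewrite -add1n -drop_drop.
  by case: (drop i l) => [|x l'] //=; rewrite usndK drop0.
rewrite /lookup drops -[i in RHS]addn0 -nth_drop.
by case: (drop i l) => [|x l'] //=; rewrite ufstK.
Qed.

Definition lookup_prog :=
  PComp fst_prog [:: PComp pred_prog [::
    PRec (PProj 0) (PComp snd_prog [:: PComp pred_prog [:: PProj 1]])]].

Lemma ev_lookup orc t i : ev orc lookup_prog [:: i; t] (lookup t i).
Proof.
apply: ev_comp1 (ev_fst _ _); apply: ev_comp1 (ev_pred _ _).
apply: ev_rec => [|m r]; first by proj.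
apply: ev_comp1 (ev_snd _ _); apply: ev_comp1 (ev_pred _ _); proj.
Qed.

(* [ELet2] splits a Cantor pair, [ECase] is zero/successor, and [ECall i e]
   applies the [i]-th function of the ambient program.  Variables are
   de Bruijn indices. *)
Inductive expr : Type :=
| EVar (i : nat) | ECst (c : nat) | ESucc (e : expr) | EPair (e1 e2 : expr)
| ELet2 (e b : expr) | ECase (e a b : expr) | ECall (i : nat) (e : expr)
| EOrc (e : expr).

(* Partial results are encoded by 0 (undefined) and k.+1 (value k). *)
Definition pbind (c : nat) (f : nat -> nat) : nat := if c is k.+1 then f k else 0.

Fixpoint den_expr (orc tab : nat -> nat) (e : expr) (env : seq nat) : nat :=
  match e with
  | EVar i => (nth 0 env i).+1
  | ECst c => c.+1
  | ESucc e => pbind (den_expr orc tab e env) (fun x => x.+2)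
  | EPair e1 e2 =>
      pbind (den_expr orc tab e1 env) (fun x =>
      pbind (den_expr orc tab e2 env) (fun y => (cpair x y).+1))
  | ELet2 e b =>
      pbind (den_expr orc tab e env) (fun z =>
      den_expr orc tab b [:: ufst z, usnd z & env])
  | ECase e a b =>
      pbind (den_expr orc tab e env) (fun z =>
      if z is k.+1 then den_expr orc tab b (k :: env) else den_expr orc tab a env)
  | ECall i e => pbind (den_expr orc tab e env) (fun z => tab (cpair i z))
  | EOrc e => pbind (den_expr orc tab e env) (fun z => (orc z).+1)
  end.

Lemma pbind_mono c c' f f' :
  (forall k, c = k.+1 -> c' = k.+1) ->
  (forall x k, f x = k.+1 -> f' x = k.+1) ->
  forall k, pbind c f = k.+1 -> pbind c' f' = k.+1.
Proof. by case: c => // x cc' ff' k /= /ff'; rewrite (cc' x). Qed.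

Lemma den_expr_mono orc tab tab' e env :
  (forall x k, tab x = k.+1 -> tab' x = k.+1) ->
  forall k, den_expr orc tab e env = k.+1 -> den_expr orc tab' e env = k.+1.
Proof.
move=> tt'; elim: e env => //=.
- by move=> e IH env; apply: pbind_mono (IH env) _.
- move=> e1 IH1 e2 IH2 env; apply: pbind_mono (IH1 env) _ => x.
  exact: pbind_mono (IH2 env) _.
- by move=> e IH b IHb env; apply: pbind_mono (IH env) _ => z; apply: IHb.
- by move=> e IH a IHa b IHb env; apply: pbind_mono (IH env) _ => -[|z] k; auto.
- by move=> i e IH env; apply: pbind_mono (IH env) _ => z; apply: tt'.
- by move=> e IH env; apply: pbind_mono (IH env) _.
Qed.

Definition computable (F : (nat -> nat) -> nat -> seq nat -> nat) : Prop :=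
  exists p, forall orc t env, ev orc p [:: t; lcode env] (F orc t env).

Lemma computable_bind K F g q :
  computable K -> computable F ->
  (forall orc z r t env, ev orc q [:: z; r; t; lcode env] (lcode (g z env))) ->
  computable (fun orc t env => pbind (K orc t env) (fun z => F orc t (g z env))).
Proof.
move=> [pK KP] [pF FP] qP.
exists (PComp (PRec PZero (PComp pF [:: PProj 2; q])) [:: pK; PProj 0; PProj 1]).
move=> orc t env; apply: ev_comp3 (KP _ _ _) _ _ _; [by proj | by proj |].
set c := K orc t env.
have -> : pbind c (fun z => F orc t (g z env)) =
          nat_rect (fun=> nat) 0 (fun z _ => F orc t (g z env)) c by case: c.
apply: ev_rec => [|z r]; first by constructor.
by apply: ev_comp2 (qP _ _ _ _ _) (FP _ _ _); proj.
Qed.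

Definition push_prog q := PComp cons_prog [:: q; PProj 3].

Lemma ev_push orc q x z r t env :
  ev orc q [:: z; r; t; lcode env] x ->
  ev orc (push_prog q) [:: z; r; t; lcode env] (lcode (x :: env)).
Proof. by move=> qx; apply: ev_comp2 qx _ (ev_cons _ _ _); proj. Qed.

Lemma computable_bind1 K F :
  computable K -> computable F ->
  computable (fun orc t env => pbind (K orc t env) (fun z => F orc t (z :: env))).
Proof.
move=> KP FP.
apply: (@computable_bind K F (fun z env => z :: env) (push_prog (PProj 0))) => // *.
by apply: ev_push; proj.
Qed.

Lemma computable_bind2 K F :
  computable K -> computable F ->
  computable (fun orc t env =>
    pbind (K orc t env) (fun z => F orc t [:: ufst z, usnd z & env])).
Proof.
move=> KP FP; pose p f := PComp f [:: PProj 0].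
apply: (@computable_bind K F (fun z env => [:: ufst z, usnd z & env])
  (PComp cons_prog [:: p fst_prog; push_prog (p snd_prog)])) => // *.
apply: ev_comp2 (ev_cons _ _ _); first by apply: ev_comp1 (ev_fst _ _); proj.
by apply: ev_push; apply: ev_comp1 (ev_snd _ _); proj.
Qed.

Lemma computable_case K F G :
  computable K -> computable F -> computable G ->
  computable (fun orc t env =>
    if K orc t env is k.+1 then G orc t (k :: env) else F orc t env).
Proof.
move=> [pK KP] [pF FP] [pG GP].
exists (PComp (PRec pF (PComp pG [:: PProj 2; push_prog (PProj 0)]))
              [:: pK; PProj 0; PProj 1]) => orc t env.
apply: ev_comp3 (KP _ _ _) _ _ _; [by proj | by proj |].
set c := K orc t env.
have -> : (if c is k.+1 then G orc t (k :: env) else F orc t env) =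
  nat_rect (fun=> nat) (F orc t env) (fun k _ => G orc t (k :: env)) c by case: c.
apply: ev_rec => // k r; apply: ev_comp2 (GP _ _ _); first by proj.
by apply: ev_push; proj.
Qed.

Lemma computable_comp1 f p K :
  (forall orc x, ev orc p [:: x] (f orc x)) -> computable K ->
  computable (fun orc t env => f orc (K orc t env)).
Proof.
move=> fp [pK KP]; exists (PComp p [:: pK]) => orc t env.
exact: ev_comp1 (KP _ _ _) (fp _ _).
Qed.

Lemma computable_comp2 f p K L :
  (forall orc x y, ev orc p [:: x; y] (f orc x y)) -> computable K -> computable L ->
  computable (fun orc t env => f orc (K orc t env) (L orc t env)).
Proof.
move=> fp [pK KP] [pL LP]; exists (PComp p [:: pK; pL]) => orc t env.
exact: ev_comp2 (KP _ _ _) (LP _ _ _) (fp _ _ _).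
Qed.

Lemma computable_const c : computable (fun _ _ _ => c).
Proof. by case: (ev_const c) => p pP; exists p. Qed.

Lemma computable_tab : computable (fun _ t _ => t).
Proof. by exists (PProj 0) => *; proj. Qed.

Lemma computable_env : computable (fun _ _ env => lcode env).
Proof. by exists (PProj 1) => *; proj. Qed.

Lemma computable_succ K : computable K -> computable (fun orc t env => (K orc t env).+1).
Proof. by apply: (@computable_comp1 (fun _ => S) PSucc); constructor. Qed.

Lemma computable_lookup K L :
  computable K -> computable L ->
  computable (fun orc t env => lookup (L orc t env) (K orc t env)).
Proof.
exact: (@computable_comp2 (fun _ i t => lookup t i) _ _ _ (fun orc i t => ev_lookup orc t i)).
Qed.

Lemma computable_ext F G :
  (forall orc t env, F orc t env = G orc t env) -> computable F -> computable G.
Proof. by move=> FG [p pP]; exists p => orc t env; rewrite -FG. Qed.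

Lemma computable_nth i : computable (fun _ _ env => nth 0 env i).
Proof.
apply: (@computable_ext (fun _ _ env => lookup (lcode env) i)).
  by move=> *; apply: lookup_lcode.
exact: computable_lookup (computable_const i) computable_env.
Qed.

Lemma computable_den e : computable (fun orc t env => den_expr orc (lookup t) e env).
Proof.
have nth0P := computable_nth 0.
have pairP K L : computable K -> computable L ->
    computable (fun orc t env => cpair (K orc t env) (L orc t env)).
  exact: (@computable_comp2 (fun _ => cpair) _ _ _ ev_pair).
have predP K : computable K -> computable (fun orc t env => (K orc t env).-1).
  exact: (@computable_comp1 (fun _ => predn) _ _ ev_pred).
elim: e => /=.
- by move=> i; apply/computable_succ/computable_nth.
- by move=> c; apply: computable_const.
- move=> e IH; apply: (computable_bind1 IH (F := fun _ _ env => (nth 0 env 0).+2)).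
  by do 2!apply: computable_succ.
- move=> e1 IH1 e2 IH2.
  pose f c1 c2 := pbind c1 (fun x => pbind c2 (fun y => (cpair x y).+1)).
  pose inner := PRec PZero (PComp cons_prog [:: PProj 2; PProj 0]).
  pose outer := PRec PZero (PComp inner [:: PProj 2; PProj 0]).
  apply: (fun fP => @computable_comp2 (fun _ => f) outer _ _ fP IH1 IH2) => orc c1 c2.
  have -> : f c1 c2 =
      nat_rect (fun=> nat) 0 (fun x _ => pbind c2 (fun y => (cpair x y).+1)) c1.
    by case: c1.
  apply: ev_rec => [|x r]; first by constructor.
  apply: (@ev_comp2 _ _ _ _ _ c2 x); [proj | proj |].
  have -> : pbind c2 (fun y => (cpair x y).+1) =
      nat_rect (fun=> nat) 0 (fun y _ => (cpair x y).+1) c2 by case: c2.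
  apply: ev_rec => [|y r']; first by constructor.
  by apply: ev_comp2 (ev_cons _ _ _); proj.
- by move=> e IH b IHb; apply: (computable_bind2 IH IHb).
- move=> e IH a IHa b IHb.
  pose sel c y := if c is _.+1 then y else 0.
  have selP orc c y : ev orc (PRec PZero (PProj 2)) [:: c; y] (sel c y).
    have -> : sel c y = nat_rect (fun=> nat) 0 (fun _ _ => y) c by case: c.
    by apply: ev_rec => [|m r]; [constructor | proj].
  have selA := @computable_comp2 (fun _ => sel) _ _ _ selP IH IHa.
  apply: computable_ext (computable_case (predP _ IH) selA IHb).
  by move=> orc t env; case: (den_expr _ _ e _) => [|[|k]].
- move=> i e IH.
  apply: (computable_bind1 IH (F := fun _ t env => lookup t (cpair i (nth 0 env 0)))).
  exact: computable_lookup (pairP _ _ (computable_const i) nth0P) computable_tab.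
- move=> e IH; apply: (computable_bind1 IH (F := fun orc _ env => (orc (nth 0 env 0)).+1)).
  apply: computable_succ.
  by apply: (@computable_comp1 (fun orc => orc) POracle) => // *; constructor.
Qed.

Section Programs.
Variable P : seq expr.

Definition func i := nth (ECst 0) P i.

Inductive big_step (orc : nat -> nat) : expr -> seq nat -> nat -> Prop :=
| bs_var i env : big_step orc (EVar i) env (nth 0 env i)
| bs_cst c env : big_step orc (ECst c) env c
| bs_succ e env x : big_step orc e env x -> big_step orc (ESucc e) env x.+1
| bs_pair e1 e2 env x y :
    big_step orc e1 env x -> big_step orc e2 env y ->
    big_step orc (EPair e1 e2) env (cpair x y)
| bs_let2 e b env z y :
    big_step orc e env z -> big_step orc b [:: ufst z, usnd z & env] y ->
    big_step orc (ELet2 e b) env y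
| bs_case0 e a b env y :
    big_step orc e env 0 -> big_step orc a env y -> big_step orc (ECase e a b) env y
| bs_caseS e a b env k y :
    big_step orc e env k.+1 -> big_step orc b (k :: env) y ->
    big_step orc (ECase e a b) env y
| bs_call i e env z y :
    big_step orc e env z -> big_step orc (func i) [:: z] y ->
    big_step orc (ECall i e) env y
| bs_orc e env z : big_step orc e env z -> big_step orc (EOrc e) env (orc z).

Definition unfold1 orc t x :=
  den_expr orc (lookup t) (func (ufst x)) [:: usnd x].

Lemma ev_unfold1 : exists p, forall orc x t, ev orc p [:: x; t] (unfold1 orc t x).
Proof.
have [p pP] : exists p, forall orc i t env, ev orc p [:: i; t; lcode env]
    (den_expr orc (lookup t) (func i) env).
  rewrite /func; elim: P => [|e Q [q qP]].
    have [p pP] := ev_const 1.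
    by exists p => orc i t env; rewrite nth_nil.
  have [pe peP] := computable_den e.
  exists (PRec pe (PComp q [:: PProj 0; PProj 2; PProj 3])) => orc i t env.
  have -> : den_expr orc (lookup t) (nth (ECst 0) (e :: Q) i) env =
    nat_rect (fun=> nat) (den_expr orc (lookup t) e env)
      (fun m _ => den_expr orc (lookup t) (nth (ECst 0) Q m) env) i by case: i.
  by apply: ev_rec => // m r; apply: ev_comp3 (qP _ _ _ _); proj.
exists (PComp p [:: PComp fst_prog [:: PProj 0]; PProj 1;
                    PComp cons_prog [:: PComp snd_prog [:: PProj 0]; PZero]]).
move=> orc x t; apply: ev_comp3 (pP _ _ _ [:: usnd x]).
- by apply: ev_comp1 (ev_fst _ _); proj.
- by proj.
apply: ev_comp2 (ev_cons _ _ _); last by constructor.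
by apply: ev_comp1 (ev_snd _ _); proj.
Qed.

(* [table orc B n] lists the values at the arguments below [B] of the [n]-th
   Kleene iterate of the program. *)
Fixpoint table orc B n :=
  if n is n'.+1 then lcode [seq unfold1 orc (table orc B n') x | x <- iota 0 B] else 0.

Lemma lookup_table0 orc B x : lookup (table orc B 0) x = 0.
Proof. by rewrite -[table _ _ _]/(lcode [::]) lookup_lcode nth_nil. Qed.

Lemma lookup_tableS orc B n x :
  lookup (table orc B n.+1) x = if x < B then unfold1 orc (table orc B n) x else 0.
Proof.
rewrite lookup_lcode; case: ltnP => [lt | le].
  by rewrite (nth_map 0) ?size_iota // nth_iota.
by rewrite nth_default // size_map size_iota.
Qed.

Lemma ev_table : exists p, forall orc B n, ev orc p [:: n; B] (table orc B n).
Proof.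
have [u uP] := ev_unfold1.
pose idx := PComp sub_prog [:: PComp PSucc [:: PProj 0]; PProj 2].
pose row := PRec PZero (PComp cons_prog [:: PComp u [:: idx; PProj 3]; PProj 1]).
have rowP orc B t :
    ev orc row [:: B; B; t] (lcode [seq unfold1 orc t x | x <- iota 0 B]).
  pose step k r := (cpair (unfold1 orc t (B - k.+1)) r).+1.
  have -> : lcode [seq unfold1 orc t x | x <- iota 0 B] =
            nat_rect (fun=> nat) 0 step B.
    suff rowk k : k <= B -> nat_rect (fun=> nat) 0 step k =
        lcode [seq unfold1 orc t x | x <- iota (B - k) k].
      by rewrite rowk // subnn.
    elim: k => //= k IH ltkB; rewrite (IH (ltnW ltkB)) /step.
    by rewrite subnSK.
  apply: ev_rec => [|k r]; first by constructor.
  apply: ev_comp2 (ev_cons _ _ _); last by proj.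
  apply: ev_comp2 (uP _ _ _); last by proj.
  apply: ev_comp2 (ev_sub _ _ _); last by proj.
  by apply: (@ev_comp1 _ _ _ _ k); [proj | constructor].
exists (PRec PZero (PComp row [:: PProj 2; PProj 2; PProj 1])) => orc B n.
have -> : table orc B n = nat_rect (fun=> nat) 0
    (fun _ t => lcode [seq unfold1 orc t x | x <- iota 0 B]) n.
  by elim: n => //= n <-.
apply: ev_rec => [|m r]; first by constructor.
by apply: ev_comp3 (rowP _ _ _); proj.
Qed.

Lemma bs_table orc e env y : big_step orc e env y -> exists N, forall B n,
  N <= B -> N <= n -> den_expr orc (lookup (table orc B n)) e env = y.+1.
Proof.
elim=> {e env y} /=.
- by move=> *; exists 0.
- by move=> *; exists 0.
- by move=> e env x _ [N IH]; exists N => B n NB Nn; rewrite IH.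
- move=> e1 e2 env x y _ [N1 IH1] _ [N2 IH2]; exists (maxn N1 N2) => B n.
  by rewrite !geq_max => /andP[? ?] /andP[? ?]; rewrite IH1 ?IH2.
- move=> e b env z y _ [N1 IH1] _ [N2 IH2]; exists (maxn N1 N2) => B n.
  by rewrite !geq_max => /andP[? ?] /andP[? ?]; rewrite IH1 //= IH2.
- move=> e a b env y _ [N1 IH1] _ [N2 IH2]; exists (maxn N1 N2) => B n.
  by rewrite !geq_max => /andP[? ?] /andP[? ?]; rewrite IH1 //= IH2.
- move=> e a b env k y _ [N1 IH1] _ [N2 IH2]; exists (maxn N1 N2) => B n.
  by rewrite !geq_max => /andP[? ?] /andP[? ?]; rewrite IH1 //= IH2.
- move=> i e env z y _ [N1 IH1] _ [N2 IH2].
  exists (maxn (cpair i z).+1 (maxn N1 N2.+1)) => B n.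
  rewrite !geq_max => /and3P[ltB ? ltN2B] /and3P[_ ? ltN2n]; rewrite IH1 //=.
  rewrite -(ltn_predK ltN2n) lookup_tableS ltB.
  by rewrite /unfold1 ufstK usndK IH2 // ?(ltnW ltN2B) // -ltnS (ltn_predK ltN2n).
- by move=> e env z _ [N IH]; exists N => B n NB Nn; rewrite IH.
Qed.

Lemma table_mono orc B B' n n' x k : B <= B' -> n <= n' ->
  lookup (table orc B n) x = k.+1 -> lookup (table orc B' n') x = k.+1.
Proof.
move=> leB; elim: n n' x k => [|n IH] [|n'] x k // le; rewrite ?lookup_table0 //.
rewrite !lookup_tableS; case: ltnP => // ltxB; rewrite (leq_trans ltxB leB).
by apply: den_expr_mono => z j; apply: IH.
Qed.

Lemma func_computable i : exists p, forall orc x y,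
  big_step orc (func i) [:: x] y -> ev orc p [:: x] y.
Proof.
have [T TP] := ev_table; have [one oneP] := ev_const 1; have [ci ciP] := ev_const i.
pose val := PComp lookup_prog [:: PComp pair_prog [:: ci; PProj 1];
                               PComp T [:: PProj 0; PProj 0]].
pose undef := PComp sub_prog [:: val; one].
pose v orc x N := lookup (table orc N N) (cpair i x).
have valP orc x N : ev orc val [:: N; x] (v orc x N).
  apply: ev_comp2 (ev_lookup _ _ _).
    by apply: ev_comp2 (ciP _ _) _ (ev_pair _ _ _); proj.
  by apply: ev_comp2 (TP _ _ _); proj.
have undefP orc x N : ev orc undef [:: N; x] (1 - v orc x N).
  exact: ev_comp2 (valP _ _ _) (oneP _ _) (ev_sub _ _ _).
exists (PComp pred_prog [:: PComp val [:: PMin undef; PProj 0]]) => orc x y xy.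
have [N0 N0P] := bs_table xy.
have vN : v orc x (maxn (cpair i x) N0).+1 = y.+1.
  rewrite /v lookup_tableS ifT ?ltnS ?leq_maxl // /unfold1 ufstK usndK N0P //.
    by rewrite leqW // leq_maxr.
  by rewrite leq_maxr.
have exN : exists N, v orc x N != 0 by exists (maxn (cpair i x) N0).+1; rewrite vN.
case: (ex_minnP exN) => N vN0 minN.
have vNy : v orc x N = y.+1.
  case vNk: (v orc x N) vN0 => [|k] // _.
  have leN : N <= (maxn (cpair i x) N0).+1 by apply: minN; rewrite vN.
  by rewrite -vN; apply/esym/(table_mono leN leN vNk).
apply: (@ev_comp1 _ _ _ _ y.+1); last exact: ev_pred.
rewrite -vNy; apply: ev_comp2 (valP _ _ _); last by proj.
apply: ev_min => [|m ltmN].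
  by have := undefP orc x N; rewrite vNy.
exists 0; have := undefP orc x m.
case: (v orc x m =P 0) => [-> //|/eqP/minN].
by rewrite leqNgt ltmN.
Qed.

End Programs.

(** * Finite types and their enumeration *)

Lemma code_sval_inj : injective code_sval.
Proof.
elim=> [|u IHu w IHw|i u IHu] [|u' w'|i' u'] //= /cpair_inj[] // _ /cpair_inj[].
  by move=> /IHu-> /IHw->.
by move=> -> /IHu->.
Qed.

HB.instance Definition _ := Equality.copy Defs.sval (inj_type code_sval_inj).

Lemma sty_nested_ind (P : sty -> Prop) :
  P S1 -> (forall a b, P a -> P b -> P (SPair a b)) ->
  (forall l, (forall i, i < size l -> P (nth S1 l i)) -> P (SSum l)) ->
  forall a, P a.
Proof.
move=> P1 PP PS; fix IH 1; case=> [|a b|l].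
- exact: P1.
- exact: PP (IH a) (IH b).
- apply: PS; elim: l => [i|a l IHl [_|i]]; [discriminate | exact: (IH a) | exact: IHl].
Qed.

Fixpoint enum_sum (l : seq sty) (i : nat) : seq Defs.sval :=
  if l is a :: l' then map (VInj i) (enum_sty a) ++ enum_sum l' i.+1 else [::].

Lemma enum_sty_sum l : enum_sty (SSum l) = enum_sum l 0.
Proof. by []. Qed.

Lemma mem_enum_sum l i v :
  (v \in enum_sum l i) =
  if v is VInj j u then (i <= j < i + size l) && (u \in enum_sty (nth S1 l (j - i)))
  else false.
Proof.
have injP k i' u s : (VInj k u \in map (VInj i') s) = (k == i') && (u \in s).
  apply/mapP/andP => [[w ws [-> ->]] | [/eqP-> us]]; [by rewrite eqxx | by exists u].
elim: l i v => [|a l IH] i v /=.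
  by rewrite in_nil; case: v => // j u; rewrite addn0 ltnNge andbN.
rewrite mem_cat IH; case: v => [|u w|j u].
- by rewrite orbF; apply/negP => /mapP[].
- by rewrite orbF; apply/negP => /mapP[].
rewrite injP addSnnS; case: (ltngtP i j) => // [ltij | ->].
  by rewrite subnS -(subnSK ltij).
by rewrite subnn addnS ltnS leq_addr orbF.
Qed.

Lemma mem_enum_sty a v : (v \in enum_sty a) = vty v a.
Proof.
elim/sty_nested_ind: a v => [|a b IHa IHb|l IH] v.
- by case: v => *; rewrite inE.
- rewrite /=; apply/allpairsP/idP => [[[u w] /= [ua wb ->]] | ].
    by rewrite /= -IHa -IHb ua wb.
  case: v => // u w /= /andP[ua wb]; exists (u, w) => /=.
  by rewrite IHa IHb.
- rewrite enum_sty_sum mem_enum_sum; case: v => // i u /=.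
  by rewrite add0n subn0; case: ltnP => //= lti; apply: IH.
Qed.

Fixpoint envs (G : seq sty) : seq (seq Defs.sval) :=
  if G is a :: G' then [seq u :: env | u <- enum_sty a, env <- envs G'] else [:: [::]].

Lemma mem_envs G env : (env \in envs G) = all2 vty env G.
Proof.
elim: G env => [|a G IH] env /=; first by case: env.
apply/allpairsP/idP => [[[u env'] /= [ua Genv ->]] | ].
  by rewrite /= -mem_enum_sty ua -IH.
case: env => // u env /= /andP[ua Genv]; exists (u, env) => /=.
by rewrite mem_enum_sty ua IH.
Qed.

Lemma vty_nth env G n : all2 vty env G -> n < size G -> vty (nth VUnit env n) (nth S1 G n).
Proof.
by elim: env G n => [|u env IH] [|a G] [|n] //= /andP[ua Genv] //; apply: IH.
Qed.

Lemma vty_veval G V a env : vtyped G V a -> all2 vty env G -> vty (veval env V) a.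
Proof.
elim=> {G V a} [G n ltn|G|G v w a b _ IHv _ IHw|G i v l lti _ IH] //= Genv.
- exact: vty_nth.
- by rewrite IHv ?IHw.
- by rewrite lti IH.
Qed.

Lemma vty_pairP v a b :
  vty v (SPair a b) -> exists u w, [/\ v = VPair u w, vty u a & vty w b].
Proof. by case: v => // u w /andP[]; exists u, w. Qed.

Lemma vty_sumP v l :
  vty v (SSum l) -> exists i u, [/\ v = VInj i u, i < size l & vty u (nth S1 l i)].
Proof. by case: v => // i u /andP[]; exists i, u. Qed.

Lemma teval_msum (M : model) (b : nat -> Defs.sval -> car M) env V Ts i u :
  veval env V = VInj i u -> i < size Ts ->
  teval b env (TMSum V Ts) = teval b (u :: env) (nth tmpl_dflt Ts i).
Proof.
by move=> /= ->; elim: Ts i => // T Ts IH [|i] //= lti; rewrite IH.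
Qed.

(** * A decision program on codes *)

(* Expressions with binders written as Rocq functions; the argument is the
   number of variables in scope and a variable is its binding level. *)
Definition src := nat -> expr.
Definition svar l : src := fun d => EVar (d - l.+1).
Definition scst c : src := fun=> ECst c.
Definition ssuc (e : src) : src := fun d => ESucc (e d).
Definition spair (e1 e2 : src) : src := fun d => EPair (e1 d) (e2 d).
Definition slet (e : src) (b : src -> src -> src) : src :=
  fun d => ELet2 (e d) (b (svar d.+1) (svar d) d.+2).
Definition scase (e a : src) (b : src -> src) : src :=
  fun d => ECase (e d) (a d) (b (svar d) d.+1).
Definition scall i (e : src) : src := fun d => ECall i (e d).
Definition sorc (e : src) : src := fun d => EOrc (e d).
Definition sfun (b : src -> src) : expr := b (svar 0) 1.

Notation "x ** y" := (spair x y) (at level 55, right associativity).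
Definition snil := scst 0.
Definition scons x l := ssuc (x ** l).
Definition slist (l a : src) (b : src -> src -> src) : src :=
  scase l a (fun p => slet p b).

Notation fNth := 0 (only parsing).
Notation fApp := 1 (only parsing).
Notation fMap := 2 (only parsing).
Notation fPairs := 3 (only parsing).
Notation fEnum := 4 (only parsing).
Notation fSums := 5 (only parsing).
Notation fEnvs := 6 (only parsing).
Notation fVal := 7 (only parsing).
Notation fTmpl := 8 (only parsing).
Notation fArgs := 9 (only parsing).
Notation fAllEnv := 10 (only parsing).
Notation fAllEqn := 11 (only parsing).
Notation fMain := 12 (only parsing).

(* The functions come in the order of the indices [fNth], ..., [fMain]. *)
Definition decider : seq expr := Eval compute in [::
  sfun (fun x => slet x (fun l i =>
    slist l snil (fun y r => scase i y (fun i' => scall fNth (r ** i')))));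
  sfun (fun x => slet x (fun l1 l2 =>
    slist l1 l2 (fun y r => scons y (scall fApp (r ** l2)))));
  sfun (fun x => slet x (fun t cl => slet cl (fun c l =>
    slist l snil (fun y r =>
      scons (scase t (scons c y) (fun=> t ** c ** y)) (scall fMap (t ** c ** r))))));
  sfun (fun x => slet x (fun t ll => slet ll (fun l1 l2 =>
    slist l1 snil (fun y r =>
      scall fApp (scall fMap (t ** y ** l2) ** scall fPairs (t ** r ** l2))))));
  sfun (fun x => slet x (fun tag p =>
    scase tag (scons (scst 0 ** scst 0) snil) (fun tag' =>
    scase tag'
      (slet p (fun a b => scall fPairs (scst 1 ** scall fEnum a ** scall fEnum b)))
      (fun=> scall fSums (p ** scst 0)))));
  sfun (fun x => slet x (fun l i =>
    slist l snil (fun a r =>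
      scall fApp (scall fMap (scst 2 ** i ** scall fEnum a) **
                  scall fSums (r ** ssuc i)))));
  sfun (fun x => slist x (scons snil snil) (fun a r =>
    scall fPairs (scst 0 ** scall fEnum a ** scall fEnvs r)));
  sfun (fun x => slet x (fun env V => slet V (fun tag p =>
    scase tag (scall fNth (env ** p)) (fun tag' =>
    scase tag' (scst 0 ** scst 0) (fun tag'' =>
    slet p (fun v w =>
    scase tag''
      (scst 1 ** scall fVal (env ** v) ** scall fVal (env ** w))
      (fun=> scst 2 ** v ** scall fVal (env ** w))))))));
  sfun (fun x => slet x (fun G x1 => slet x1 (fun env x2 => slet x2 (fun T k =>
    slet T (fun tag p => slet p (fun q r =>
    let val V := scall fVal (env ** V) in
    scase tag
      (scase k (scst 0 ** q ** val r)
         (fun k' => slet k' (fun kenv kT =>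
            scall fTmpl (G ** scons (val r) kenv ** kT ** scst 0))))
      (fun tag' =>
    scase tag'
      (slet (val q) (fun _ uw => slet uw (fun u w =>
         scall fTmpl (G ** scons u (scons w env) ** r ** k))))
      (fun tag'' =>
    scase tag''
      (slet (val q) (fun _ iu => slet iu (fun i u =>
         scall fTmpl (G ** scons u env ** scall fNth (r ** i) ** k))))
      (fun=> slet r (fun V T' => slet G (fun sig H =>
         scase k
           (scall fTmpl (G ** scons (val V) snil ** scall fNth (H ** q) **
                         ssuc (env ** T')))
           (fun=> slet (scall fNth (sig ** q)) (fun _ b =>
              scst 1 ** q ** val V **
              scall fArgs (G ** env ** T' ** k ** scall fEnum b))))))))))))));
  sfun (fun x => slet x (fun G x1 => slet x1 (fun env x2 => slet x2 (fun T x3 =>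
    slet x3 (fun k l =>
    slist l snil (fun y r =>
      scons (scall fTmpl (G ** scons y env ** T ** k))
            (scall fArgs (G ** env ** T ** k ** r))))))));
  sfun (fun x => slet x (fun G x1 => slet x1 (fun T1 x2 => slet x2 (fun T2 l =>
    slist l (scst 1) (fun env r =>
      scase (sorc (scall fTmpl (G ** env ** T1 ** scst 0) **
                   scall fTmpl (G ** env ** T2 ** scst 0)))
        (scst 0) (fun=> scall fAllEnv (G ** T1 ** T2 ** r)))))));
  sfun (fun x => slet x (fun G l =>
    slist l (scst 1) (fun e r =>
      slet e (fun ctx e1 => slet e1 (fun _ e2 => slet e2 (fun T1 T2 =>
      scase (scall fAllEnv (G ** T1 ** T2 ** scall fEnvs ctx))
        (scst 0) (fun=> scall fAllEqn (G ** r))))))));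
  sfun (fun x => slet x (fun sig y => slet y (fun E H =>
    scall fAllEqn ((sig ** H) ** E))))
].

Section Runs.
Variable orc : nat -> nat.

Definition runs i z y : Prop := big_step decider orc (func decider i) [:: z] y.

Let B := big_step decider orc.

Lemma bs_let2_pair e b env x z y :
  B e env (cpair x z) -> B b [:: x, z & env] y -> B (ELet2 e b) env y.
Proof. by move=> ez bxz; apply: bs_let2 ez _; rewrite ufstK usndK. Qed.

Lemma bs_case e a b env z y :
  B e env z -> (if z is k.+1 then B b (k :: env) y else B a env y) ->
  B (ECase e a b) env y.
Proof. by case: z => [|k] ez; [apply: bs_case0 | apply: bs_caseS]. Qed.

Lemma run_progs i e env z y : B e env z -> runs i z y -> B (ECall i e) env y.
Proof. exact: bs_call. Qed.

End Runs.

Local Opaque cpair.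

Create HintDb runs.

Ltac run_step :=
  lazymatch goal with
  | |- big_step _ _ (EVar ?i) ?env _ =>
      let v := eval cbv [nth] in (nth 0 env i) in
      exact (bs_var _ _ i env : big_step _ _ (EVar i) env v)
  | |- big_step _ _ (ECst _) _ _ => apply: bs_cst
  | |- big_step _ _ (ESucc _) _ _ => apply: bs_succ
  | |- big_step _ _ (EPair _ _) _ _ => apply: bs_pair
  | |- big_step _ _ (ELet2 _ _) _ _ => eapply bs_let2_pair
  | |- big_step _ _ (ECase _ _ _) _ _ => eapply bs_case
  | |- big_step _ _ (ECall _ _) _ _ => eapply run_progs
  | |- big_step _ _ (EOrc _) _ _ => apply: bs_orc
  | |- match ?z with _ => _ end => progress cbv beta match
  | |- runs _ _ _ _ => solve [eassumption | eauto 2 with runs nocore]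
  end.
Ltac run_prog :=
  lazymatch goal with |- runs _ _ _ _ =>
    rewrite /runs; cbv [func nth decider]; repeat run_step end.

Section Specs.
Variable orc : nat -> nat.
Notation runs := (runs orc).

Lemma runs_nth A (f : A -> nat) d l i :
  i < size l -> runs fNth (cpair (clist f l) i) (f (nth d l i)).
Proof.
elim: l i => // x l IH [|i] /= lti; first by run_prog.
by have := IH i lti => ?; run_prog.
Qed.

Lemma runs_app l1 l2 : runs fApp (cpair (lcode l1) (lcode l2)) (lcode (l1 ++ l2)).
Proof. by elim: l1 => [|x l IH] /=; run_prog. Qed.

Lemma clist_map A (f : A -> nat) l : clist f l = lcode (map f l).
Proof. by elim: l => //= x l ->. Qed.

(* [fMap] in mode 0 conses [c]; in mode [t > 0] it pairs under the tag [t],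
   which covers both [VPair c _] (tag 1) and [VInj c _] (tag 2). *)
Definition tagged t c y := if t is t'.+1 then cpair t (cpair c y) else (cpair c y).+1.

Lemma runs_map t c l :
  runs fMap (cpair t (cpair c (lcode l))) (lcode (map (tagged t c) l)).
Proof.
elim: l => [|x l IH] /=; first by run_prog.
by case: t IH => [|t] IH; run_prog.
Qed.

Hint Resolve runs_map runs_app : runs.

Lemma runs_pairs t l1 l2 :
  runs fPairs (cpair t (cpair (lcode l1) (lcode l2)))
              (lcode [seq tagged t u w | u <- l1, w <- l2]).
Proof. by elim: l1 => [|x l IH] /=; run_prog. Qed.

Hint Resolve runs_pairs : runs.

Lemma map_allpairs A B C D (h : C -> D) (f : A -> B -> C) s t :
  map h [seq f x y | x <- s, y <- t] = [seq h (f x y) | x <- s, y <- t].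
Proof.
rewrite map_flatten -map_comp; congr flatten.
by apply: eq_map => x /=; rewrite -map_comp.
Qed.

Lemma runs_enum a : runs fEnum (code_sty a) (clist code_sval (enum_sty a)).
Proof.
elim/sty_nested_ind: a => [|a b IHa IHb|l IH].
- by rewrite /=; run_prog.
- rewrite !(clist_map code_sval) in IHa IHb *.
  rewrite [map _ _]map_allpairs.
  have -> : [seq code_sval (VPair u w) | u <- enum_sty a, w <- enum_sty b] =
     [seq tagged 1 u w | u <- map code_sval (enum_sty a), w <- map code_sval (enum_sty b)].
    by rewrite allpairs_mapl allpairs_mapr.
  by rewrite [code_sty _]/=; run_prog.
have runs_sums i : runs fSums (cpair (clist code_sty l) i)
                              (lcode (map code_sval (enum_sum l i))).
  elim: l i IH => [|a l IHl] i IH; rewrite /=; first by run_prog.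
  have := IH 0 isT; rewrite /= (clist_map code_sval) => IHa.
  have {IHl} := IHl i.+1 (fun j => IH j.+1) => IHl.
  rewrite map_cat -map_comp.
  have -> : map (code_sval \o VInj i) (enum_sty a) =
     map (tagged 2 i) (map code_sval (enum_sty a)) by rewrite -map_comp.
  by run_prog.
by rewrite enum_sty_sum (clist_map code_sval) [code_sty _]/=; run_prog.
Qed.

Hint Resolve runs_enum : runs.

Lemma runs_envs G : runs fEnvs (clist code_sty G) (clist (clist code_sval) (envs G)).
Proof.
elim: G => [|a G IH]; first by rewrite /=; run_prog.
rewrite !(clist_map (clist code_sval)) in IH *.
have ra := runs_enum a; rewrite (clist_map code_sval) in ra.
have -> : map (clist code_sval) (envs (a :: G)) =
    [seq tagged 0 u w | u <- map code_sval (enum_sty a), w <- map (clist code_sval) (envs G)].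
  by rewrite allpairs_mapl allpairs_mapr [LHS]map_allpairs.
by rewrite [clist _ _]/=; run_prog.
Qed.

Lemma runs_val G V a env : vtyped G V a -> all2 vty env G ->
  runs fVal (cpair (clist code_sval env) (code_vterm V)) (code_sval (veval env V)).
Proof.
elim=> {G V a} [G n ltn|G|G v w a b _ IHv _ IHw|G i v l lti _ IH] Genv /=.
- have ltn' : n < size env by move: Genv; rewrite all2E => /andP[/eqP->].
  by have := runs_nth code_sval VUnit ltn' => ?; run_prog.
- by run_prog.
- by have {}IHv := IHv Genv; have {}IHw := IHw Genv; run_prog.
- by have {}IH := IH Genv; run_prog.
Qed.

Definition tcode (t : term (nat * Defs.sval)) : nat :=
  code_term (tsubst (fun p => TV (cpair p.1 (code_sval p.2))) t).

Lemma tcode_op o a ts :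
  tcode (TO o a ts) = cpair 1 (cpair o (cpair (code_sval a) (clist tcode ts))).
Proof.
rewrite /tcode /=; do 3!congr cpair.
by rewrite (clist_map code_term) (clist_map tcode) -map_comp.
Qed.

Section Templates.
Variables (sig : signature) (H : seq tmpl).
Hypothesis wfH : wf_handlers sig H.

Definition gcode := cpair (code_sig sig) (clist code_tmpl H).

(* [k] is 0 when operations are interpreted by the handlers, and the successor
   of a pair (environment, template) when [fTmpl] evaluates a handler whose
   continuation is that template. *)
Definition tmpl_arg env T k :=
  cpair gcode (cpair (clist code_sval env) (cpair (code_tmpl T) k)).

Lemma runs_args env T k (h : Defs.sval -> nat) (l : seq Defs.sval) :
  (forall x, x \in l -> runs fTmpl (tmpl_arg (x :: env) T k) (h x)) ->
  runs fArgs (cpair gcode (cpair (clist code_sval env) (cpair (code_tmpl T)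
                (cpair k (clist code_sval l))))) (clist h l).
Proof.
elim: l => [|x l IH] hl; first by rewrite /=; run_prog.
have hx := hl x (mem_head x l).
have {}IH := IH (fun y yl => hl y (mem_behead (s := x :: l) yl)).
by rewrite /tmpl_arg /= in hx *; run_prog.
Qed.

Lemma runs_sig o : o < size sig ->
  runs fNth (cpair (code_sig sig) o) (cpair (code_sty (argty sig o)) (code_sty (resty sig o))).
Proof. exact: (runs_nth (fun p => cpair (code_sty p.1) (code_sty p.2)) (S1, S1)). Qed.

Lemma runs_handler_op G Z T env kenv kT (K : nat -> Defs.sval -> term _) :
  ttyped sig G Z T -> all2 vty env G ->
  (forall j v, j < size Z -> vty v (nth S1 Z j) ->
     runs fTmpl (tmpl_arg (v :: kenv) kT 0) (tcode (K j v))) ->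
  runs fTmpl (tmpl_arg env T (cpair (clist code_sval kenv) (code_tmpl kT)).+1)
    (tcode (@teval (termmodel sig) K env T)).
Proof.
move=> TT; elim: TT env => {G Z T}
  [G Z j V ltj VT|G Z V T a b VT _ IH|G Z V Ts l VT sz _ IH|G Z o V T lto VT _ IH] env Genv ZK.
- have rV := runs_val VT Genv; have rK := ZK _ _ ltj (vty_veval VT Genv).
  by rewrite /tmpl_arg /= in rK *; run_prog.
- have rV := runs_val VT Genv; have [u [w [Vuw ua wb]]] := vty_pairP (vty_veval VT Genv).
  have Tenv : all2 vty [:: u, w & env] [:: a, b & G] by rewrite /= ua wb.
  have rT := IH _ Tenv ZK; rewrite /= Vuw; rewrite Vuw in rV.
  by rewrite /tmpl_arg /= in rT rV *; run_prog.
- have rV := runs_val VT Genv; have [i [u [Viu lti ui]]] := vty_sumP (vty_veval VT Genv).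
  have Tenv : all2 vty (u :: env) (nth S1 l i :: G) by rewrite /= ui.
  have rT := IH _ lti _ Tenv ZK; rewrite (teval_msum _ Viu) ?sz //.
  have rN : runs fNth (cpair (clist code_tmpl Ts) i) (code_tmpl (nth tmpl_dflt Ts i)).
    by apply: runs_nth; rewrite sz.
  by rewrite Viu in rV; rewrite /tmpl_arg /= in rT rV *; run_prog.
- have rV := runs_val VT Genv; have rN := runs_sig lto; have rE := runs_enum (resty sig o).
  rewrite /= tcode_op (clist_map tcode) -map_comp -(clist_map (tcode \o _)).
  set k := (cpair _ _).+1.
  have hA x : x \in enum_sty (resty sig o) ->
      runs fTmpl (tmpl_arg (x :: env) T k) (tcode (@teval (termmodel sig) K (x :: env) T)).
    by rewrite mem_enum_sty => xo; apply: IH => //; rewrite /= xo.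
  have {hA} rA := runs_args hA.
  by rewrite /tmpl_arg /= {}/k in rA rV *; run_prog.
Qed.

Definition hterm env T : term (nat * Defs.sval) :=
  @teval (hmodel H (termmodel sig)) (fun j v => TV (j, v)) env T.

Lemma runs_hterm G Z T env : ttyped sig G Z T -> all2 vty env G ->
  runs fTmpl (tmpl_arg env T 0) (tcode (hterm env T)).
Proof.
move=> TT; elim: TT env => {G Z T}
  [G Z j V ltj VT|G Z V T a b VT _ IH|G Z V Ts l VT sz _ IH|G Z o V T lto VT _ IH] env Genv.
- have rV := runs_val VT Genv.
  by rewrite /tmpl_arg /=; run_prog.
- have rV := runs_val VT Genv; have [u [w [Vuw ua wb]]] := vty_pairP (vty_veval VT Genv).
  have Tenv : all2 vty [:: u, w & env] [:: a, b & G] by rewrite /= ua wb.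
  have rT := IH _ Tenv; rewrite /hterm /= Vuw; rewrite Vuw in rV.
  by rewrite /tmpl_arg /= in rT rV *; run_prog.
- have rV := runs_val VT Genv; have [i [u [Viu lti ui]]] := vty_sumP (vty_veval VT Genv).
  have Tenv : all2 vty (u :: env) (nth S1 l i :: G) by rewrite /= ui.
  have rT := IH _ lti _ Tenv; rewrite /hterm (teval_msum _ Viu) ?sz //.
  have rN : runs fNth (cpair (clist code_tmpl Ts) i) (code_tmpl (nth tmpl_dflt Ts i)).
    by apply: runs_nth; rewrite sz.
  by rewrite Viu in rV; rewrite /tmpl_arg /= in rT rV *; run_prog.
- have rV := runs_val VT Genv; have [szH HT] := wfH.
  have rN : runs fNth (cpair (clist code_tmpl H) o) (code_tmpl (nth tmpl_dflt H o)).
    by apply: runs_nth; rewrite szH.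
  have aT : all2 vty [:: veval env V] [:: argty sig o] by rewrite /= (vty_veval VT Genv).
  have hK j v : j < size [:: resty sig o] -> vty v (nth S1 [:: resty sig o] j) ->
      runs fTmpl (tmpl_arg (v :: env) T 0) (tcode (hterm (v :: env) T)).
    by case: j => // _ vo; apply: IH; rewrite /= vo.
  have {hK} rT := runs_handler_op (HT _ lto) aT hK.
  by rewrite /tmpl_arg /= in rT rV *; run_prog.
Qed.

Definition query e env := cpair (tcode (hterm env (eq_lhs e))) (tcode (hterm env (eq_rhs e))).

Definition eqn_ok e := all (fun env => orc (query e env) != 0) (envs (eq_ctx e)).

Lemma runs_eqn e :
  ttyped sig (eq_ctx e) (eq_tctx e) (eq_lhs e) ->
  ttyped sig (eq_ctx e) (eq_tctx e) (eq_rhs e) ->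
  runs fAllEnv (cpair gcode (cpair (code_tmpl (eq_lhs e)) (cpair (code_tmpl (eq_rhs e))
                  (clist (clist code_sval) (envs (eq_ctx e)))))) (eqn_ok e).
Proof.
move=> lT rT; rewrite /eqn_ok.
have : {subset envs (eq_ctx e) <= envs (eq_ctx e)} by [].
elim: {1 3 4}(envs _) => [|env l IH] sub; first by rewrite /=; run_prog.
have Genv : all2 vty env (eq_ctx e) by rewrite -mem_envs sub ?mem_head.
have {}IH := IH (fun x xl => sub x (mem_behead (s := env :: l) xl)).
have hl := runs_hterm lT Genv; have hr := runs_hterm rT Genv.
rewrite /tmpl_arg /= in hl hr *; rewrite /query.
by case oE: (orc (cpair (tcode _) _)) => [|n] /=; run_prog; rewrite oE; repeat run_step.
Qed.

Lemma runs_theory E : wf_theory sig E ->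
  runs fAllEqn (cpair gcode (clist code_eqn E)) (all eqn_ok E).
Proof.
elim: E => [|e E IH] wfE; first by rewrite /=; run_prog.
have [lT rT] := wfE e (or_introl erefl).
have {}IH := IH (fun e' e'E => wfE e' (or_intror e'E)).
have he := runs_eqn lT rT; rewrite /= /code_eqn.
have hctx := runs_envs (eq_ctx e).
by case: (eqn_ok e) he => /= he; run_prog.
Qed.

Lemma runs_main E : wf_theory sig E ->
  runs fMain (code_input sig E H) (all eqn_ok E).
Proof. by move/runs_theory => rE; rewrite /code_input; run_prog. Qed.

End Templates.
End Specs.

(** * Correctness as provability *)

Section Parametricity.
Variables (sig : signature).

Definition op_related (M N : model) (R : car M -> car N -> Prop) : Prop :=
  forall o a (k : Defs.sval -> car M) (k' : Defs.sval -> car N),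
    o < size sig -> vty a (argty sig o) ->
    (forall v, vty v (resty sig o) -> R (k v) (k' v)) ->
    R (@mop M o a k) (@mop N o a k').

Lemma teval_related (M N : model) (R : car M -> car N -> Prop) G Z T b b' env :
  op_related R -> ttyped sig G Z T -> all2 vty env G ->
  (forall j v, j < size Z -> vty v (nth S1 Z j) -> R (b j v) (b' j v)) ->
  R (teval b env T) (teval b' env T).
Proof.
move=> opR TT; elim: TT env => {G Z T}
  [G Z j V ltj VT|G Z V T a b1 VT _ IH|G Z V Ts l VT sz _ IH|G Z o V T lto VT _ IH] env Genv bR.
- exact: bR (vty_veval VT Genv).
- have [u [w [Vuw ua wb]]] := vty_pairP (vty_veval VT Genv).
  by rewrite /= Vuw; apply: IH => //=; rewrite ua wb.
- have [i [u [Viu lti ui]]] := vty_sumP (vty_veval VT Genv).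
  by rewrite !(teval_msum _ Viu) ?sz //; apply: IH => //=; rewrite ui.
- apply: opR => // [|v vo]; first exact: vty_veval VT Genv.
  by apply: IH => //=; rewrite vo.
Qed.

Lemma hmodel_related H (M N : model) (R : car M -> car N -> Prop) :
  wf_handlers sig H -> op_related R ->
  @op_related (hmodel H M) (hmodel H N) R.
Proof.
move=> [_ HT] opR o a k k' lto ao kR; apply: teval_related (HT o lto) _ _ => //=.
  by rewrite ao.
by case=> // v _ vo; apply: kR.
Qed.

Definition extensional M := @op_related M M eq.

End Parametricity.

Section Provability.
Variables (sig : signature) (E : theory).

Lemma term_nested_ind X (P : term X -> Prop) :
  (forall x, P (TV x)) -> (forall o a ts, List.Forall P ts -> P (TO o a ts)) ->
  forall t, P t.
Proof.
move=> PV PO; fix IH 1; case=> [x|o a ts]; first exact: PV.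
by apply: PO; elim: ts => [|t ts IHts]; constructor.
Qed.

Lemma prov_nested_ind X (P : term X -> term X -> Prop) :
  (forall t, wft sig t -> P t t) ->
  (forall t s, prov sig E t s -> P t s -> P s t) ->
  (forall t s r, prov sig E t s -> P t s -> prov sig E s r -> P s r -> P t r) ->
  (forall o a ts ss, wft sig (TO o a ts) -> wft sig (TO o a ss) ->
     List.Forall2 (prov sig E) ts ss -> List.Forall2 P ts ss ->
     P (TO o a ts) (TO o a ss)) ->
  (forall e c (s : nat * Defs.sval -> term X),
     List.In e E -> all2 vty c (eq_ctx e) ->
     wft sig (tsubst s (Tc sig c (eq_lhs e))) ->
     wft sig (tsubst s (Tc sig c (eq_rhs e))) ->
     P (tsubst s (Tc sig c (eq_lhs e))) (tsubst s (Tc sig c (eq_rhs e)))) ->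
  forall t s, prov sig E t s -> P t s.
Proof.
move=> Prefl Psym Ptrans Pcong Pax; fix IH 3 => t s; case.
- exact: Prefl.
- by move=> t' s' ts; apply: Psym (ts) (IH _ _ ts).
- by move=> t' s' r ts sr; apply: Ptrans (ts) (IH _ _ ts) (sr) (IH _ _ sr).
- move=> o a ts ss wt ws tsss; apply: Pcong => //.
  by elim: tsss => [|t' s' ts' ss' h hs IHs]; constructor; [exact: IH | exact: IHs].
- exact: Pax.
Qed.

Lemma wft_prov X (t s : term X) : prov sig E t s -> wft sig t /\ wft sig s.
Proof.
elim/prov_nested_ind => {t s} //.
- by move=> t s _ [].
- by move=> t s r _ [wt _] _ [_ wr].
Qed.

Lemma tsubst_comp X Y Z (f : Y -> term Z) (g : X -> term Y) t :
  tsubst f (tsubst g t) = tsubst (fun x => tsubst f (g x)) t.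
Proof.
elim/term_nested_ind: t => //= o a ts IH; congr TO; rewrite -map_comp.
by elim: IH => //= {}t {}ts -> _ ->.
Qed.

Lemma wft_tsubst X Y (f : X -> term Y) t :
  (forall x, wft sig (f x)) -> wft sig t -> wft sig (tsubst f t).
Proof.
move=> wf; elim/term_nested_ind: t => //= o a ts IH /and4P[-> -> sz wts] /=.
rewrite size_map sz /= all_map {sz}.
by elim: IH wts => //= {}t {}ts IHt _ IHts /andP[/IHt-> /IHts].
Qed.

Lemma prov_tsubst X Y (f : X -> term Y) t s :
  (forall x, wft sig (f x)) -> prov sig E t s ->
  prov sig E (tsubst f t) (tsubst f s).
Proof.
move=> wf; elim/prov_nested_ind => {t s}.
- by move=> t wt; apply/pv_refl/wft_tsubst.
- by move=> t s _; apply: pv_sym.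
- by move=> t s r _ ts _; apply: pv_trans ts.
- move=> o a ts ss wt ws _ IH; apply: pv_cong.
  + exact: wft_tsubst wf wt.
  + exact: wft_tsubst wf ws.
  by elim: IH => //= *; constructor.
- move=> e c s eE cG wl wr; rewrite !tsubst_comp.
  by apply: pv_ax => //; rewrite -tsubst_comp; apply: wft_tsubst.
Qed.

Section Classes.
Variable X : Type.
Implicit Types (c : fcar sig E X) (t s : term X).

Definition reps c t : Prop := proj1_sig c t.

Lemma reps_prov c t s : reps c t -> reps c s -> prov sig E t s.
Proof.
by rewrite /reps; case: c => _ /= [r [_ ->]] rt; apply: pv_trans (pv_sym rt).
Qed.

Lemma prov_reps c t s : reps c t -> prov sig E t s -> reps c s.
Proof. by rewrite /reps; case: c => _ /= [r [_ ->]]; apply: pv_trans. Qed.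

Lemma reps_inj c c' t : reps c t -> reps c' t -> c = c'.
Proof.
move=> ct c't; have eq s : proj1_sig c s = proj1_sig c' s.
  apply: propositional_extensionality; split=> [cs|c's].
    exact: prov_reps c't (reps_prov ct cs).
  exact: prov_reps ct (reps_prov c't c's).
case: c c' {ct c't} eq => [Q hQ] [Q' hQ'] /= eq.
have {}eq : Q = Q' by apply: functional_extensionality.
by case: Q' / eq hQ' => hQ'; congr exist; apply: proof_irrelevance.
Qed.

Lemma frepP c : wft sig (frep c) /\ reps c (frep c).
Proof.
rewrite /frep; case: constructive_indefinite_description => t [wt eq] /=.
by split=> //; rewrite /reps eq; apply: pv_refl.
Qed.

Lemma reps_fcls t (wt : wft sig t) : reps (fcls E wt) t.
Proof. exact: pv_refl. Qed.

Lemma reps_fop o a (k : Defs.sval -> fcar sig E X) K :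
  o < size sig -> vty a (argty sig o) ->
  (forall v, vty v (resty sig o) -> reps (k v) (K v)) ->
  reps (fop o a k) (TO o a (map K (enum_sty (resty sig o)))).
Proof.
move=> lto ao kK; set en := enum_sty _.
have enP v : v \in en -> reps (k v) (K v) by rewrite mem_enum_sty => /kK.
have wt : wft sig (TO o a (map (fun v => frep (k v)) en)).
  rewrite /= lto ao size_map eqxx all_map /=; apply/allP => v _ /=.
  by case: (frepP (k v)).
have wK : wft sig (TO o a (map K en)).
  rewrite /= lto ao size_map eqxx all_map /=; apply/allP => v /enP kv /=.
  by case: (wft_prov (reps_prov kv kv)).
have -> : reps (fop o a k) = prov sig E (TO o a (map (fun v => frep (k v)) en)).
  rewrite /reps /fop -/en; set t := TO _ _ _ in wt *.
  suff gen b (e : wft sig t = b) :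
      proj1_sig ((if b as bb return wft sig t = bb -> fcar sig E X
        then fun h => fcls E h else fun _ => k VUnit) e) = prov sig E t by apply: gen.
  by case: b e => // e; rewrite wt in e.
apply: pv_cong => //; elim: (en) enP => [|v l IH] lP /=; constructor.
  apply: reps_prov (lP v (mem_head v l)); exact: (frepP _).2.
by apply: IH => w wl; apply: lP; rewrite inE wl orbT.
Qed.

End Classes.

Lemma extensional_freemod X : extensional sig (freemod sig E X).
Proof.
move=> o a k k' lto ao kk'; pose K v := frep (k v).
apply: (@reps_inj _ _ _ (TO o a (map K (enum_sty (resty sig o))))).
  by apply: reps_fop => // v _; apply: (frepP _).2.
by apply: reps_fop => // v /kk' <-; apply: (frepP _).2.
Qed.

Lemma reps_termmodel X (f : nat * Defs.sval -> term X) :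
  @op_related sig (freemod sig E X) (termmodel sig) (fun c t => reps c (tsubst f t)).
Proof. by move=> o a k k' lto ao kk' /=; rewrite -map_comp; apply: reps_fop. Qed.

End Provability.

Section Correctness.
Variables (sig : signature) (E : theory) (H : seq tmpl).
Hypotheses (wfE : wf_theory sig E) (wfH : wf_handlers sig H).

Definition var_code (p : nat * Defs.sval) := cpair p.1 (code_sval p.2).

Lemma var_code_inj : injective var_code.
Proof. by move=> [j v] [j' v'] /cpair_inj[/= -> /code_sval_inj->]. Qed.

Definition nterm env T : term nat :=
  tsubst (fun p => TV (var_code p)) (hterm sig H env T).

Definition provably_correct : Prop :=
  forall e env, List.In e E -> all2 vty env (eq_ctx e) ->
    prov sig E (nterm env (eq_lhs e)) (nterm env (eq_rhs e)).

Lemma freemod_hterm X (f : nat * Defs.sval -> term X) G Z T env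
    (b : nat -> Defs.sval -> fcar sig E X) :
  ttyped sig G Z T -> all2 vty env G -> (forall j v, reps (b j v) (f (j, v))) ->
  reps (@teval (hmodel H (freemod sig E X)) b env T) (tsubst f (hterm sig H env T)).
Proof.
move=> TT Genv bf.
apply: (@teval_related sig (hmodel H (freemod sig E X)) (hmodel H (termmodel sig))
          (fun c t => reps c (tsubst f t)) G Z) => //.
exact: (@hmodel_related sig H (freemod sig E X) (termmodel sig)
          (fun c t => reps c (tsubst f t)) wfH (@reps_termmodel sig E X f)).
Qed.

Lemma freemod_correct X :
  provably_correct -> satisfies (hmodel H (freemod sig E X)) E.
Proof.
move=> ok e eE env Genv b.
pose dec n := if excluded_middle_informative (exists p, var_code p = n) is left h
  then proj1_sig (constructive_indefinite_description _ h) else (0, VUnit).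
have decK p : dec (var_code p) = p.
  rewrite /dec; case: excluded_middle_informative => [h|[]]; last by exists p.
  by case: constructive_indefinite_description => q /= /var_code_inj.
pose f n := frep (b (dec n).1 (dec n).2).
have wf n : wft sig (f n) by case: (frepP (b (dec n).1 (dec n).2)).
have bf j v : reps (b j v) (f (var_code (j, v))) by rewrite /f decK; apply: (frepP _).2.
have [lT rT] := wfE eE.
have hl := freemod_hterm (f := fun p => f (var_code p)) lT Genv bf.
have hr := freemod_hterm (f := fun p => f (var_code p)) rT Genv bf.
apply: reps_inj hl _; apply: prov_reps hr _; apply: pv_sym.
by have := prov_tsubst wf (ok e env eE Genv); rewrite !tsubst_comp.
Qed.

Lemma satisfies_related (M N : model) (h : car M -> car N) :
  op_related sig (fun x y => h x = y) -> satisfies (hmodel H N) E ->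
  forall e env b, List.In e E -> all2 vty env (eq_ctx e) ->
  h (@teval (hmodel H M) b env (eq_lhs e)) = h (@teval (hmodel H M) b env (eq_rhs e)).
Proof.
move=> hR okN e env b eE Genv; have [lT rT] := wfE eE.
have hb G Z T : ttyped sig G Z T -> all2 vty env G ->
    h (@teval (hmodel H M) b env T) = @teval (hmodel H N) (fun j v => h (b j v)) env T.
  move=> TT GT; apply: (@teval_related sig (hmodel H M) (hmodel H N)
    (fun x y => h x = y) G Z) => //.
  exact: (@hmodel_related sig H M N (fun x y => h x = y) wfH hR).
by rewrite (hb _ _ _ lT Genv) (hb _ _ _ rT Genv); apply: okN.
Qed.

Definition good (M : model) : Prop := extensional sig M /\ satisfies (hmodel H M) E.

Lemma good_unit : good unitmod.
Proof.
split=> [o a k k' *|e eE env Genv b]; first by [].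
by case: (teval _ _ _); case: (teval _ _ _).
Qed.

Lemma good_prod M N : good M -> good N -> good (prodmod M N).
Proof.
move=> [extM okM] [extN okN]; split=> [o a k k' lto ao kk' /=|e eE env Genv b].
  by congr pair; [apply: extM | apply: extN] => // v /kk' ->.
rewrite [LHS]surjective_pairing [RHS]surjective_pairing; congr pair.
  apply: (@satisfies_related (prodmod M N) M fst) => // o a k k' lto ao kk'.
  exact: extM.
apply: (@satisfies_related (prodmod M N) N snd) => // o a k k' lto ao kk'.
exact: extN.
Qed.

Lemma good_exp Y M : good M -> good (expmod Y M).
Proof.
move=> [extM okM]; split=> [o a k k' lto ao kk' /=|e eE env Genv b];
  apply: functional_extensionality => y.
  by apply: extM => // v /kk' ->.
apply: (@satisfies_related (expmod Y M) M (fun h => h y)) => // o a k k' lto ao kk'.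
exact: extM.
Qed.

Lemma good_cden : provably_correct -> forall C, good (cden sig E C).
Proof.
move=> ok; fix IH 1; case=> [A|Cs|A C].
- by split; [exact: extensional_freemod | exact: freemod_correct].
- elim: Cs => [|C Cs IHCs]; first exact: good_unit.
  exact: good_prod (IH C) IHCs.
- exact: good_exp (IH C).
Qed.

Lemma finite_vtyp N : exists (A : vtyp) (f : nat -> vden sig E A) (g : vden sig E A -> nat),
  forall n, n <= N -> g (f n) = n.
Proof.
suff [f [g fg]] : exists (f : nat -> vden sig E (VSum (nseq N.+1 VOne))) g,
  forall n, n <= N -> g (f n) = n by exists (VSum (nseq N.+1 VOne)), f, g.
elim: N => [|N [f [g fg]]].
  by exists (fun _ => inl tt), (fun _ => 0); case.
exists (fun n => if n is n'.+1 then inr (f n') else inl tt).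
exists (fun x => if x is inr y then (g y).+1 else 0).
by case=> // n ltnN; rewrite fg.
Qed.

Lemma tsubst_bound V (code : V -> nat) (t : term V) : exists N, forall h : nat -> nat,
  (forall n, n <= N -> h n = n) ->
  tsubst (fun x => TV (h (code x))) t = tsubst (fun x => TV (code x)) t.
Proof.
elim/term_nested_ind: t => [x|o a ts IH].
  by exists (code x) => h hN /=; rewrite hN.
suff [N NP] : exists N, forall h : nat -> nat, (forall n, n <= N -> h n = n) ->
    map (tsubst (fun x => TV (h (code x)))) ts = map (tsubst (fun x => TV (code x))) ts.
  by exists N => h /NP /= ->.
elim: IH => {ts} [|t ts [N1 P1] _ [N2 P2]]; first by exists 0.
exists (maxn N1 N2) => h hN /=.
by rewrite P1 ?P2 // => n le; apply: hN; rewrite leq_max le ?orbT.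
Qed.

Lemma correct_provably : handlers_correct sig E H -> provably_correct.
Proof.
move=> ok e env eE Genv; have [lT rT] := wfE eE.
have [N1 P1] := tsubst_bound var_code (hterm sig H env (eq_lhs e)).
have [N2 P2] := tsubst_bound var_code (hterm sig H env (eq_rhs e)).
have [A [f [g fg]]] := finite_vtyp (maxn N1 N2).
pose X := vden sig E A; pose F p : term X := TV (f (var_code p)).
pose b j v : fcar sig E X := fcls E (erefl : wft sig (F (j, v)) = true).
have bF j v : reps (b j v) (F (j, v)) by apply: reps_fcls.
have hl := freemod_hterm (f := F) lT Genv bF.
have hr := freemod_hterm (f := F) rT Genv bF.
rewrite (ok (CF A) e eE env Genv b) in hl.
have wg (x : X) : wft sig (TV (g x)) by [].
have := prov_tsubst wg (reps_prov hl hr); rewrite !tsubst_comp /=.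
rewrite /nterm -(P1 (g \o f)) -?(P2 (g \o f)) // => n le; apply: fg;
  by rewrite leq_max le ?orbT.
Qed.

Lemma handlers_correctP : handlers_correct sig E H <-> provably_correct.
Proof. by split=> [/correct_provably|/good_cden ok C] //; case: (ok C). Qed.

Lemma decides_correct orc : decides_Tf sig E orc ->
  (all (eqn_ok orc sig H) E : Prop) <-> handlers_correct sig E H.
Proof.
move=> orcP; have queryP e env :
    orc (query sig H e env) != 0 <->
    prov sig E (nterm env (eq_lhs e)) (nterm env (eq_rhs e)).
  have [h1 h0] := orcP (nterm env (eq_lhs e)) (nterm env (eq_rhs e)).
  rewrite -/(query sig H e env) in h1 h0; split=> [|/h1 -> //].
  by move=> /eqP nz; apply: NNPP => /h0.
rewrite handlers_correctP /provably_correct.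
have allP' : all (eqn_ok orc sig H) E <-> forall e, List.In e E -> eqn_ok orc sig H e.
  elim: (E) => [|e l IH] /=; first by split.
  split=> [/andP[ok /IH okl] e' [<- //|/okl //]|ok].
  by rewrite ok; [apply/IH => e' el; apply: ok; right | left].
rewrite allP'; split=> [ok e env /ok/allP oke Genv|ok e eE].
  by apply/queryP/oke; rewrite mem_envs.
by apply/allP => env; rewrite mem_envs => Genv; apply/queryP/ok.
Qed.

End Correctness.

Theorem theorem6p6 :
  exists p : prog,
  forall (sig : signature) (E : theory) (H : seq tmpl),
    wf_theory sig E -> wf_handlers sig H ->
    forall orc : nat -> nat, decides_Tf sig E orc ->
      (handlers_correct sig E H -> ev orc p [:: code_input sig E H] 1) /\
      (~ handlers_correct sig E H -> ev orc p [:: code_input sig E H] 0).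
Proof.
have [p pP] := func_computable decider fMain.
exists p => sig E H wfE wfH orc orcP.
have [ok_correct correct_ok] := decides_correct wfE wfH orcP.
have run := pP _ _ _ (runs_main orc wfH wfE).
by case: (all _ _) run ok_correct correct_ok => run /= oc co; split=> // h;
  [case: h; apply: oc | have := co h].
Qed.
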